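(* Let $G$ be the Grushin plane, equipped with its Carnot-Carathéodory distance $d_{CC}$, and let $\mathbb{R}^2$ carry the Euclidean metric. Let $F: G \rightarrow \mathbb{R}^2$ be defined in coordinates by $F(x, y) = (x|x|, y)$. Then $F$ is quasisymmetric.
   Context: Grushin plane: $G$ is the metric completion of $\{(x,y) \in \mathbb{R}^2 : x \neq 0\}$ equipped with the Riemannian metric $ds^2 = dx^2 + x^{-2}dy^2$. It has the coordinate structure of $\mathbb{R}^2$ (as a set, $G = \mathbb{R}^2$), and it is a metric space under the Carnot-Carathéodory distance defined as follows. A vector of $\mathbb{R}^2$ is horizontal if it has the form $(t,0)$ with $t$ real. For $g,h \in G$ let $\Gamma_{g,h}$ be the set of all (piecewise continuously differentiable) curves $\gamma = (x(\cdot),y(\cdot)): [0,1] \rightarrow G$ with $\gamma(0)=g$, $\gamma(1)=h$, and with $\dot\gamma(t)$ horizontal for each $t \in [0,1]$ such that $\gamma(t)$ lies on the $y$-axis (one-sided derivatives at break points). Then $$d_{CC}(g,h) = \inf_{\gamma \in \Gamma_{g,h}} \int_0^1 \sqrt{(\dot x(t))^2 + x(t)^{-2}(\dot y(t))^2}\, dt,$$ where the term $x(t)^{-2}(\dot y(t))^2$ is read as $0$ when $x(t)=0$ (where $\dot y(t)=0$). Quasisymmetry: let $(X,d_X)$ and $(Y,d_Y)$ be metric spaces and $f: X \rightarrow Y$ an injective map. For an increasing homeomorphism $\eta: (0,\infty) \rightarrow (0,\infty)$, $f$ is $\eta$-quasisymmetric if for all $z_1,z_2,z_3 \in X$ with $z_2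 \neq z_1$ and $z_3 \neq z_1$, $$\frac{d_Y(f(z_3),f(z_1))}{d_Y(f(z_2),f(z_1))} \leq \eta\left(\frac{d_X(z_3,z_1)}{d_X(z_2,z_1)}\right).$$ $f$ is quasisymmetric if it is $\eta$-quasisymmetric for some such $\eta$. *)

(* Defs.v *)
From HB Require Import structures.
From mathcomp Require Import all_boot all_order all_algebra.
From mathcomp Require Import all_classical all_reals all_analysis.

Set Implicit Arguments.
Unset Strict Implicit.
Unset Printing Implicit Defensive.

Import Order.TTheory GRing.Theory Num.Theory.
Import numFieldNormedType.Exports.

Local Open Scope classical_set_scope.
Local Open Scope ring_scope.

Section Quasisymmetry.
Context {R : realType}.

Definition homeomorphism_pos (eta : R -> R) : Prop :=
  exists theta : R -> R,
  [/\ forall t : R, 0 < t -> 0 < eta t /\ theta (eta t) = t,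
      forall t : R, 0 < t -> 0 < theta t /\ eta (theta t) = t,
      {within `]0, +oo[, continuous eta} &
      {within `]0, +oo[, continuous theta}].

Definition increasing_pos (eta : R -> R) : Prop :=
  forall s t : R, 0 < s -> s < t -> eta s < eta t.

(* dX and dY are the metrics of X and Y. They are explicit arguments because
   the library's norm on R * R is the sup norm. *)
Definition eta_quasisymmetric (X Y : Type) (dX : X -> X -> R)
    (dY : Y -> Y -> R) (eta : R -> R) (f : X -> Y) : Prop :=
  injective f /\
  forall z1 z2 z3 : X, z2 <> z1 -> z3 <> z1 ->
    dY (f z3) (f z1) / dY (f z2) (f z1) <= eta (dX z3 z1 / dX z2 z1).

Definition quasisymmetric (X Y : Type) (dX : X -> X -> R)
    (dY : Y -> Y -> R) (f : X -> Y) : Prop :=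
  exists eta : R -> R,
  [/\ homeomorphism_pos eta, increasing_pos eta &
      eta_quasisymmetric dX dY eta f].

End Quasisymmetry.

(* Points of the Grushin plane are given by their coordinates in R * R. *)
Section Grushin.
Context {R : realType}.

Definition euclidean_dist (p q : R * R) : R :=
  Num.sqrt ((p.1 - q.1) ^+ 2 + (p.2 - q.2) ^+ 2).

(* f is continuously differentiable on `[a, b] with derivative f'; the
   derivatives at a and b are one-sided. *)
Definition C1_on (a b : R) (f f' : R -> R) : Prop :=
  {within `[a, b], continuous f'} /\
  forall t, t \in `[a, b] ->
    (f s - f t) / (s - t) @[s --> within `[a, b] t^'] --> f' t.

(* The restriction of gamma to `[0, 1] is piecewise C1, and on each closed
   piece its derivative is horizontal at the points of the y-axis, so that at
   a break point both one-sided derivatives are constrained. Continuity of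
   gamma on `[0, 1] follows, the pieces being closed. *)
Definition admissible_curve (gamma : R -> R * R) : Prop :=
  exists2 s : seq R, itv_partition 0 1 s &
  forall i, (i < size s)%N ->
    let a := nth 1 (0 :: s) i in
    let b := nth 1 s i in
    exists x' y' : R -> R,
    [/\ C1_on a b (fun t => (gamma t).1) x',
        C1_on a b (fun t => (gamma t).2) y' &
        forall t, t \in `[a, b] -> (gamma t).1 = 0 -> y' t = 0].

(* Lebesgue integral with values in [0, +oo]. The finitely many break points,
   where derive1 is arbitrary, are negligible. Since 0^-1 = 0, the second term
   is 0 where the curve meets the y-axis. *)
Definition CC_length (gamma : R -> R * R) : \bar R :=
  let x t := (gamma t).1 in
  let y t := (gamma t).2 in
  (\int[lebesgue_measure]_(t in `[0%R, 1%R])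
     (Num.sqrt ((derive1 x t) ^+ 2 + (x t) ^- 2 * (derive1 y t) ^+ 2))%:E)%E.

(* fine is harmless: any two points are joined by an admissible curve of
   finite length. *)
Definition CC_dist (g h : R * R) : R :=
  fine (ereal_inf [set CC_length gamma | gamma in
    [set gamma | [/\ admissible_curve gamma, gamma 0 = g & gamma 1 = h]]]).

Definition grushin_map (p : R * R) : R * R := (p.1 * `|p.1|, p.2).

End Grushin.

(* Main.v *)
Require Import Defs.
From mathcomp Require Import all_boot all_order all_algebra ring lra.
From mathcomp Require Import all_classical all_reals all_analysis.
From mathcomp Require Import measurable_realfun.

(* Write d = d_CC(g, h), a = |x(h)| and E = |F(g) - F(h)|. The point is that
   E is comparable to d (d + a), where a depends on the base point h only.
   - Along an admissible curve of length L from g to h one has |x| <= L + a,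
     hence |y'| <= (L + a) |y' / x|, and integrating gives E <= 3 L (L + a).
   - Conversely, with v = |y(g) - y(h)| and r = sqrt(v + a^2), going
     horizontally to the vertical line through h, out to |x| = r, and changing
     y there costs at most 2 |x(g) - x(h)| + 11 v / r =: K, and
     K (K + a) <= 258 E.
   If two points have distances d2 and d3 = t d2 to h, then
   E3 / E2 <= 774 d3 (d3 + a) / (d2 (d2 + a)) <= 774 (t + t^2). *)

Set Implicit Arguments.
Unset Strict Implicit.
Unset Printing Implicit Defensive.

Import Order.TTheory GRing.Theory Num.Theory.
Import numFieldNormedType.Exports.

Local Open Scope classical_set_scope.
Local Open Scope ring_scope.

(** * One-sided and two-sided derivatives on closed pieces *)

Section C1.
Context {R : realType}.
Implicit Types (f g : R -> R) (a b c t l : R).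

(** The shift [s = h + t] carries the filter of slopes to that of the difference quotients defining
    [is_derive]. *)
Lemma cvg_slopeP f t l :
  ((f s - f t) / (s - t) @[s --> t^'] --> l) <-> is_derive t 1 f l.
Proof.
have E : nbhs ((f s - f t) / (s - t) @[s --> t^']) =
         nbhs (h^-1 *: ((f \o shift t) (h *: 1) - f t) @[h --> 0^']).
  apply/funext => P.
  apply: etrans
    (near_shift 0 t (fun s => s != t -> P ((f s - f t) / (s - t)))) _.
  rewrite subr0; congr (nbhs _ _); apply/funext => h /=.
  by rewrite -subr_eq0 addrK [h *: 1]mulr1 [_ *: _]mulrC.
split=> [|[+ <-]]; last by rewrite /cvg_to E.
rewrite /cvg_to E => H.
by apply: DeriveDef; [apply/cvg_ex; exists l|apply: cvg_lim].
Qed.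

(** Near an interior point, the constraint of staying in [[a, b]] is void. *)
Lemma C1_on_is_derive a b f f' t :
  C1_on a b f f' -> t \in `]a, b[ -> is_derive t 1 f (f' t).
Proof.
move=> [_ H] tab; apply/cvg_slopeP.
apply: cvg_trans (H t (subset_itv_oo_cc tab)); apply: cvg_app => A HA.
have tn : \forall s \near t^', s \in `[a, b].
  apply: cvg_within; apply: filterS (near_in_itvoo tab) => s.
  exact: subset_itv_oo_cc.
have {}HA : \forall s \near t^', s \in `[a, b] -> A s.
  exact: HA.
by apply: filterS2 HA tn => s; apply.
Qed.

Lemma is_derive_C1_on a b f f' :
  (forall t, is_derive t 1 f (f' t)) -> continuous f' -> C1_on a b f f'.
Proof.
move=> df cf'; split=> [|t _]; first exact: continuous_subspaceT.
by apply: cvg_within_filter; apply/cvg_slopeP.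
Qed.

Lemma eq_C1_on a b f g f' :
  {in `[a, b], f =1 g} -> C1_on a b g f' -> C1_on a b f f'.
Proof.
move=> fg [cf' dg]; split=> // t tab; apply: cvg_trans (dg t tab).
apply: near_eq_cvg; near=> s; rewrite !fg //; near: s.
exact: withinT.
Unshelve. all: by end_near. Qed.

(** Away from [t], [f s] is [f t] plus the slope times [s - t], and the slope converges; the point
    [t] itself is then added back. *)
Lemma C1_on_continuous a b f f' :
  C1_on a b f f' -> {within `[a, b], continuous f}.
Proof.
move=> [_ df]; apply/subspace_continuousP => t tab.
have H : f s @[s --> within `[a, b] t^'] --> f t.
  have st : s - t @[s --> within `[a, b] t^'] --> 0.
    rewrite -[X in _ --> X](subrr t); apply: cvgB; last exact: cvg_cst.
    by apply: cvg_within_filter; exact: cvg_within.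
  have : f t + (f s - f t) / (s - t) * (s - t) @[s --> within `[a, b] t^'] -->
      f t + f' t * 0.
    by apply: cvgD; [exact: cvg_cst|apply: cvgM => //; exact: df].
  rewrite mulr0 addr0; apply: cvg_trans; apply: near_eq_cvg.
  apply: cvg_within; apply: filterS (nbhs_dnbhs_neq t) => s st'.
  by rewrite divfK ?subr_eq0// addrC subrK.
move=> P Pt.
have {}H : \forall s \near t, s != t -> s \in `[a, b] -> P (f s) by exact: H.
suff : \forall s \near t, s \in `[a, b] -> P (f s) by [].
apply: filterS H => s Ps sab; have [->|] := eqVneq s t; last by move/Ps; exact.
exact: nbhs_singleton.
Qed.

Lemma C1_onS a b c d f f' : `[c, d] `<=` `[a, b] ->
  C1_on a b f f' -> C1_on c d f f'.
Proof.
move=> S [cf' df]; split; first exact: continuous_subspaceW cf'.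
move=> t tcd; apply: cvg_trans (df t (S t tcd)).
by apply: cvg_app; apply: within_subset.
Qed.

End C1.

(** * Increments of piecewise C1 functions bounded by integrals *)

Section Increments.
Context {R : realType}.
Implicit Types (f g G : R -> R) (a b c t : R) (s : seq R).
Local Notation mu := (@lebesgue_measure R).

(** Fundamental theorem of calculus. The bound by [G] is asked on the open interval only, since
    [derive1] is uncontrolled at break points. *)
Lemma C1_on_increment a b f f' G : a <= b ->
    C1_on a b f f' -> (forall t, 0 <= G t) -> measurable_fun `]a, b[ G ->
    {in `]a, b[, forall t, `|f' t| <= G t} ->
  (`|f b - f a|%:E <= \int[mu]_(t in `[a, b]) (G t)%:E)%E.
Proof.
rewrite le_eqVlt => /predU1P[<- _ G0 _ _|ab C1 G0 mG f'G].
  by rewrite subrr normr0; apply: integral_ge0 => t _; rewrite lee_fin.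
have cf' : {within `[a, b], continuous f'} by case: C1.
have df : derivable_oo_LRcontinuous f a b.
  have [_ fa fb] := (continuous_within_itvP f ab).1 (C1_on_continuous C1).
  by split=> // t /(C1_on_is_derive C1) [].
have f'E : {in `]a, b[, derive1 f =1 f'}.
  by move=> t /(C1_on_is_derive C1) [_ <-]; rewrite derive1E.
have mf' : measurable_fun `]a, b[ f'.
  apply: measurable_funS (_ : measurable_fun `[a, b] f') => //.
    exact: subset_itv_oo_cc.
  exact: subspace_continuous_measurable_fun.
rewrite (_ : `|f b - f a|%:E = `|(f b)%:E - (f a)%:E|)%E//.
rewrite -(continuous_FTC2 ab cf' df f'E).
rewrite !(@integral_itv_bndoo _ a b _ true false); [|exact/measurable_EFinP..].
apply: le_trans (le_abse_integral _ _ _) _ => //; first exact/measurable_EFinP.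
apply: ge0_le_integral => //=.
- by apply/measurable_EFinP; exact: measurableT_comp mf'.
- exact/measurable_EFinP.
Qed.

(** Pieces are added from the right: [P] is what is known on one piece, [Q] what accumulates up to
    [b]. *)
Lemma itv_partition_ind (P Q : R -> R -> Prop) b :
    Q b b ->
    (forall a c, a < c -> c <= b -> P a c -> Q c b -> Q a b) ->
  forall s a, itv_partition a b s ->
    (forall i, (i < size s)%N -> P (nth 1 (a :: s) i) (nth 1 s i)) ->
  a <= b /\ Q a b.
Proof.
move=> Qb Qstep; elim=> [|c s IH] a; first by move=> [_ /eqP /= ->].
move=> /[dup] abs [/= /andP[ac _] _] Ps.
have [cb Qc] := IH c (itv_partition_cons abs) (fun i => Ps i.+1).
split; first exact/ltW/(lt_le_trans ac).
by apply: (Qstep a c) => //; exact: (Ps 0%N).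
Qed.

Lemma measurable_fun_itvU a b c G : a <= c -> c <= b ->
  measurable_fun `]a, c[ G -> measurable_fun `[c, b] G ->
  measurable_fun `[a, b] G.
Proof.
move=> ac cb mac mcb.
rewrite (@itv_bndbnd_setU _ _ (BLeft a) (BLeft c) (BRight b)) ?bnd_simp//.
by apply/measurable_funU => //; split=> //; apply: measurable_fun_itv_co mac.
Qed.

Lemma ge0_integral_itvU a b c G : a <= c -> c <= b ->
  measurable_fun `[a, b] G -> (forall t, 0 <= G t) ->
  (\int[mu]_(t in `[a, b]) (G t)%:E =
   \int[mu]_(t in `[a, c]) (G t)%:E + \int[mu]_(t in `[c, b]) (G t)%:E)%E.
Proof.
move=> ac cb mG G0.
have E : [set` `[a, b]] = [set` `[a, c[] `|` [set` `[c, b]].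
  by apply: itv_bndbnd_setU; rewrite ?bnd_simp.
rewrite -[in RHS]integral_itv_bndo_bndc; last first.
  by apply/measurable_EFinP; apply: measurable_funS mG => //; rewrite E; left.
rewrite E ge0_integral_setU//.
- by rewrite -E; apply/measurable_EFinP.
- by move=> t _; rewrite lee_fin.
- apply/disj_setPS => t [/=]; rewrite !in_itv/= => /andP[_ tc] /andP[ct _].
  by move: tc; rewrite ltNge ct.
Qed.

(** Every time [t] is compared with the right endpoint, so that the bound controls [x] along the
    whole curve and not only at its ends. *)
Lemma piecewise_C1_increment a b s f G :
    itv_partition a b s -> (forall t, 0 <= G t) -> measurable_fun `[a, b] G ->
    (forall i, (i < size s)%N ->
      let u := nth 1 (a :: s) i in let v := nth 1 s i in
      exists2 f', C1_on u v f f' &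
        {in `]u, v[, forall t, t \in `[a, b] -> `|f' t| <= G t}) ->
  forall t, t \in `[a, b] ->
  (`|f t - f b|%:E <= \int[mu]_(t in `[a, b]) (G t)%:E)%E.
Proof.
move=> abs G0 mG fs.
pose P (u v : R) := exists2 f', C1_on u v f f' &
  {in `]u, v[, forall t, t \in `[a, b] -> `|f' t| <= G t}.
(* The premise [a <= u] is carried along because [G] bounds [f'] only at points of [[a, b]]. *)
pose Q (u v : R) := a <= u -> measurable_fun `[u, v] G ->
  forall t, t \in `[u, v] ->
  (`|f t - f v|%:E <= \int[mu]_(t in `[u, v]) (G t)%:E)%E.
suff [_ /(_ (lexx a) mG)] : a <= b /\ Q a b by [].
apply: (@itv_partition_ind P) fs => //
  [_ _ t|u v uv vb [f' C1 f'G] Qv au mub t].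
  rewrite itvxx => /eqP ->; rewrite subrr normr0.
  by apply: integral_ge0 => ? _; rewrite lee_fin.
have mv : measurable_fun `[v, b] G.
  by apply: measurable_funS mub => //; apply: subset_itvr; rewrite bnd_simp ltW.
have {}Qv := Qv (ltW (le_lt_trans au uv)) mv.
rewrite in_itv/= => /andP[ut tb].
(* Beyond [v] the induction hypothesis applies on a smaller interval; otherwise the increment from
   [t] is cut at [v]. *)
have [tv|vt] := leP t v; last first.
  apply: le_trans (Qv t _) _; first by rewrite in_itv/= ltW.
  apply: ge0_subset_integral => //; first exact/measurable_EFinP.
    by move=> ? _; rewrite lee_fin.
  by apply: subset_itvr; rewrite bnd_simp ltW.
have mub' : measurable_fun `[t, b] G.
  by apply: measurable_funS mub => //; apply: subset_itvr; rewrite bnd_simp.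
apply: (@le_trans _ _ (\int[mu]_(x in `[t, b]) (G x)%:E)%E); last first.
  apply: ge0_subset_integral => //; first exact/measurable_EFinP.
    by move=> ? _; rewrite lee_fin.
  by apply: subset_itvr; rewrite bnd_simp.
rewrite (@ge0_integral_itvU t b v)//.
apply: (@le_trans _ _ (`|f v - f t|%:E + `|f v - f b|%:E)%E).
  by rewrite -EFinD lee_fin (distrC (f v)) ler_distD.
have vvb : v \in `[v, b] by rewrite in_itv/= lexx.
apply: leeD (Qv v vvb); apply: (@C1_on_increment _ _ _ f') => //.
- by apply: C1_onS C1 => //; apply: subset_itvr; rewrite bnd_simp.
- apply: measurable_funS mub' => // x /=; rewrite !in_itv/= => /andP[tx xv].
  by rewrite (ltW tx) ltW ?(lt_le_trans xv).
move=> x; rewrite in_itv/= => /andP[tx xv].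
have ux := le_lt_trans ut tx.
apply: f'G; rewrite in_itv/= ?ux ?xv//.
by rewrite (le_trans au (ltW ux)) (le_trans (ltW xv) vb).
Qed.

End Increments.

(** * Image distance bounded by the length of a curve *)

Section Upper.
Context {R : realType}.
Implicit Types (g h : R * R) (gamma : R -> R * R) (a b c t L : R).
Local Notation mu := (@lebesgue_measure R).

Lemma normr_le_sqrt_sqrD (u v : R) : 0 <= v -> `|u| <= Num.sqrt (u ^+ 2 + v).
Proof. by move=> v0; rewrite -sqrtr_sqr ler_wsqrtr// lerDl. Qed.

Lemma sqrt_sqrD_le (u v : R) : Num.sqrt (u ^+ 2 + v ^+ 2) <= `|u| + `|v|.
Proof.
rewrite -[leRHS]ger0_norm ?addr_ge0// -sqrtr_sqr; apply: ler_wsqrtr.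
rewrite [leRHS]sqrrD !real_normK ?num_real// addrAC lerDl.
by rewrite mulrn_wge0 ?mulr_ge0.
Qed.

Lemma euclidean_dist_le (p q : R * R) :
  euclidean_dist p q <= `|p.1 - q.1| + `|p.2 - q.2|.
Proof. exact: sqrt_sqrD_le. Qed.

Lemma euclidean_dist_ge (p q : R * R) :
  `|p.1 - q.1| <= euclidean_dist p q /\ `|p.2 - q.2| <= euclidean_dist p q.
Proof.
split; first by apply: normr_le_sqrt_sqrD; rewrite sqr_ge0.
by rewrite /euclidean_dist [X in Num.sqrt X]addrC normr_le_sqrt_sqrD ?sqr_ge0.
Qed.

Lemma mulr_normB_le (u v : R) :
  `|u * `|u| - v * `|v| | <= `|u - v| * (`|u| + `|v|).
Proof.
by case: (ger0P u) => u0; case: (ger0P v) => v0;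
  case: (ger0P (u - v)) => uv; rewrite ler_norml; nra.
Qed.

(** For equal signs both norms come to [|u^2 - v^2|]; for opposite signs this is
    [(|u| + |v|)^2 <= 2 (u^2 + v^2)]. *)
Lemma mulr_normB_ge (u v : R) :
  `|u - v| * (`|u| + `|v|) <= 2 * `|u * `|u| - v * `|v| |.
Proof.
have := sqr_ge0 (u + v); have := sqr_ge0 (u - v).
have [u0|u0] := ger0P u; have [v0|v0] := ger0P v.
all: have [uv|uv] := ger0P (u - v).
all: have [w|w] := ger0P (_ - _ * _); nra.
Qed.

Definition speed gamma t : R :=
  let x t := (gamma t).1 in
  let y t := (gamma t).2 in
  Num.sqrt ((derive1 x t) ^+ 2 + (x t) ^- 2 * (derive1 y t) ^+ 2).

Lemma CC_lengthE gamma :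
  CC_length gamma = (\int[mu]_(t in `[0%R, 1%R]) (speed gamma t)%:E)%E.
Proof. by []. Qed.

Lemma speed_ge0 gamma t : 0 <= speed gamma t.
Proof. exact: sqrtr_ge0. Qed.

Lemma normr_derive1_fst_le_speed gamma t :
  `|derive1 (fun t => (gamma t).1) t| <= speed gamma t.
Proof.
by apply: normr_le_sqrt_sqrD; rewrite mulr_ge0 ?sqr_ge0// invr_ge0 sqr_ge0.
Qed.

Lemma normr_derive1_snd_le_speed gamma t :
    ((gamma t).1 = 0 -> derive1 (fun t => (gamma t).2) t = 0) ->
  `|derive1 (fun t => (gamma t).2) t| <= `|(gamma t).1| * speed gamma t.
Proof.
have [-> /(_ erefl) ->|x0 _] := eqVneq (gamma t).1 0.
  by rewrite !normr0 mul0r.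
rewrite -ler_pdivrMl ?normr_gt0// -normfV -normrM /speed [X in Num.sqrt X]addrC.
by rewrite -exprVn -exprMn normr_le_sqrt_sqrD ?sqr_ge0.
Qed.

Lemma measurable_speed_C1 gamma a b x' y' :
    C1_on a b (fun t => (gamma t).1) x' ->
    C1_on a b (fun t => (gamma t).2) y' ->
  measurable_fun `]a, b[ (speed gamma).
Proof.
move=> Cx Cy.
have S : [set` `]a, b[] `<=` [set` `[a, b]] by exact: subset_itv_oo_cc.
have M (f : R -> R) : {within `[a, b], continuous f} ->
    measurable_fun `]a, b[ f.
  move=> cf; apply: measurable_funS S _ => //.
  exact: subspace_continuous_measurable_fun.
have mx := M _ (C1_on_continuous Cx).
have mx' := M _ (proj1 Cx); have my' := M _ (proj1 Cy).
(* The factor [x^-2] may be discontinuous where [x = 0]. As a real power of [|x|] it is measurable,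
   and both expressions are 0 at 0. *)
apply: (@eq_measurable_fun _ _ _ _ _ (fun t => Num.sqrt (x' t ^+ 2 +
    `|(gamma t).1| `^ (- 2) * y' t ^+ 2))).
  move=> t; rewrite inE/= => tab; rewrite /speed !derive1E.
  have [_ ->] := C1_on_is_derive Cx tab; have [_ ->] := C1_on_is_derive Cy tab.
  by rewrite powRN powR_mulrn// real_normK ?num_real.
apply: measurableT_comp.
  by apply: continuous_measurable_fun; exact: sqrt_continuous.
apply: measurable_funD; first exact: measurable_funX.
apply: measurable_funM; last exact: measurable_funX.
by apply: (measurableT_comp (measurable_powR _)); exact: measurableT_comp.
Qed.

Lemma measurable_speed gamma : admissible_curve gamma ->
  measurable_fun `[0 : R, 1] (speed gamma).
Proof.
move=> [s s01 H].
pose P (a b : R) := measurable_fun `]a, b[ (speed gamma).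
pose Q (a b : R) := measurable_fun `[a, b] (speed gamma).
suff [] : 0 <= (1 : R) /\ Q 0 1 by [].
apply: (@itv_partition_ind _ P) s01 _.
- by rewrite /Q set_itv1; exact: measurable_fun_set1.
- move=> a c ac c1 Pac; apply: measurable_fun_itvU => //; exact: ltW.
move=> i si; have [x' [y' [Cx Cy _]]] := H i si.
exact: measurable_speed_C1 Cx Cy.
Qed.

Lemma CC_length_ge0 gamma : (0 <= CC_length gamma)%E.
Proof. by apply: integral_ge0 => t _; rewrite lee_fin; exact: speed_ge0. Qed.

Lemma admissible_fst_le gamma t : admissible_curve gamma -> t \in `[0, 1] ->
  (`|(gamma t).1 - (gamma 1).1|%:E <= CC_length gamma)%E.
Proof.
move=> adm t01; have mN := measurable_speed adm.
case: adm => s s01 H; rewrite CC_lengthE.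
apply: (@piecewise_C1_increment _ 0 1 s (fun t => (gamma t).1) _
  s01 (speed_ge0 gamma) mN _ t t01) => i si /=.
have [x' [y' [Cx _ _]]] := H i si; exists x' => // u uab _.
have [_ <-] := C1_on_is_derive Cx uab.
by rewrite -derive1E; exact: normr_derive1_fst_le_speed.
Qed.

Lemma admissible_snd_le gamma (M : R) : admissible_curve gamma -> 0 <= M ->
    (forall t, t \in `[0, 1] -> `|(gamma t).1| <= M) ->
  (`|(gamma 0).2 - (gamma 1).2|%:E <= M%:E * CC_length gamma)%E.
Proof.
move=> adm M0 xM; have mN := measurable_speed adm.
case: adm => s s01 H.
have MN0 t : 0 <= M * speed gamma t by rewrite mulr_ge0 ?speed_ge0.
have mMN : measurable_fun `[0 : R, 1] (fun t => M * speed gamma t).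
  exact: measurable_funM.
have z01 : 0 \in `[0, 1 : R] by rewrite in_itv/= lexx ler01.
rewrite CC_lengthE -ge0_integralZl_EFin//; last 2 first.
- by move=> t _; rewrite lee_fin; exact: speed_ge0.
- exact/measurable_EFinP.
apply: (@piecewise_C1_increment _ 0 1 s (fun t => (gamma t).2) _
  s01 MN0 mMN _ 0 z01) => i si /=.
have [x' [y' [_ Cy y'0]]] := H i si; exists y' => // t tab t01.
have [_ y'E] := C1_on_is_derive Cy tab; rewrite -y'E -derive1E.
apply: le_trans (normr_derive1_snd_le_speed _) _ => [x0|].
  by rewrite derive1E y'E y'0//; exact: subset_itv_oo_cc.
by rewrite ler_wpM2r ?speed_ge0 ?xM.
Qed.

Lemma grushin_dist_le_length gamma L : admissible_curve gamma ->
    CC_length gamma = L%:E ->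
  euclidean_dist (grushin_map (gamma 0)) (grushin_map (gamma 1)) <=
  3 * (L * (L + `|(gamma 1).1|)).
Proof.
move=> adm lenL; have L0 : 0 <= L by rewrite -lee_fin -lenL CC_length_ge0.
have xL t : t \in `[0, 1] -> `|(gamma t).1 - (gamma 1).1| <= L.
  by move=> t01; rewrite -lee_fin -lenL; exact: admissible_fst_le.
have := @admissible_snd_le gamma (L + `|(gamma 1).1|) adm.
rewrite lenL -EFinM lee_fin => yL.
have {yL} := yL (addr_ge0 L0 (normr_ge0 _)).
have xM t : t \in `[0, 1] -> `|(gamma t).1| <= L + `|(gamma 1).1|.
  move=> t01; apply: le_trans (lerD (xL t t01) (lexx _)).
  by rewrite -{1}[(gamma t).1](subrK (gamma 1).1) ler_normD.
move=> /(_ xM) yL.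
have z01 : 0 \in `[0, 1 : R] by rewrite in_itv/= lexx ler01.
have xL0 := xL 0 z01; have xM0 := xM 0 z01.
apply: le_trans (euclidean_dist_le _ _) _ => /=.
have := mulr_normB_le (gamma 0).1 (gamma 1).1.
(* With [a = |(gamma 1).1|], the first coordinates contribute [L (L + 2 a)] and the second
   [L (L + a)]; the sum is at most [3 L (L + a)]. *)
have : `|(gamma 0).1 - (gamma 1).1| * (`|(gamma 0).1| + `|(gamma 1).1|) <=
    L * (L + `|(gamma 1).1| + `|(gamma 1).1|).
  by apply: ler_pM => //; rewrite ?addr_ge0 ?lerD2r.
have := mulr_ge0 L0 (normr_ge0 (gamma 1).1); have := mulr_ge0 L0 L0.
by move: yL; nra.
Qed.
End Upper.

(** * An explicit short curve between two points *)

Section Lower.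
Context {R : realType}.
Implicit Types (g h : R * R) (gamma : R -> R * R) (a b c t L : R).
Local Notation mu := (@lebesgue_measure R).

Lemma horner_C1_on a b (p : {poly R}) : C1_on a b (horner p) (horner (deriv p)).
Proof.
by apply: is_derive_C1_on; exact: continuous_horner.
Qed.

Lemma speed_le gamma t (A B : R) : 0 <= B ->
    `|derive1 (fun t => (gamma t).1) t| <= A ->
    `|derive1 (fun t => (gamma t).2) t| <= `|(gamma t).1| * B ->
  speed gamma t <= A + B.
Proof.
move=> B0 xA yB; rewrite /speed -exprVn -exprMn.
apply: le_trans (sqrt_sqrD_le _ _) (lerD xA _).
have [->|x0] := eqVneq (gamma t).1 0; first by rewrite invr0 mul0r normr0.
by rewrite normrM normfV ler_pdivrMl ?normr_gt0.
Qed.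

Lemma integral_itvcc_le a b (f : R -> R) (K : R) : a <= b ->
    measurable_fun `]a, b[ f -> (forall t, 0 <= f t) ->
    {in `]a, b[, forall t, f t <= K} ->
  (\int[mu]_(t in `[a, b]) (f t)%:E <= (K * (b - a))%:E)%E.
Proof.
move=> ab mf f0 fK.
rewrite (@integral_itv_bndoo _ a b _ true false); last exact/measurable_EFinP.
apply: (@le_trans _ _ (\int[mu]_(t in `]a, b[) (cst K%:E t))%E).
  apply: ge0_le_integral => //.
  - by move=> t _; rewrite lee_fin.
  - exact/measurable_EFinP.
rewrite integral_cst//= lebesgue_measure_itv/= lte_fin EFinM.
move: ab; rewrite le_eqVlt => /predU1P[<-|->]; last by rewrite EFinB.
by rewrite ltxx subrr.
Qed.

Section Connect.
Context (g h : R * R).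
Let a := `|h.1|.
Let v := `|g.2 - h.2|.
Let r := Num.sqrt (v + h.1 ^+ 2).
(** The value at 0 is 1, so that the loop leaves the y-axis even when [h] lies on it and [v] is
    positive. *)
Let sgn : R := if 0 <= h.1 then 1 else -1.

(* The curve runs horizontally from g to the vertical line through h, then
   closes up by the loop x = h.1 + sgn * (r - a) * 8 p, y' = 24 (h.2 - g.2) p,
   where p = (1 - t) * (2 t - 1) vanishes at 1/2 and 1, has integral 1/24 and
   maximum 1/8. As a = `|h.1| and 8 p <= 1, on the loop `|x| >= 8 p r, whence
   `|y' / x| <= 3 v / r. If r = 0 then v = 0 and v / r = 0. *)
Let px1 : {poly R} := g.1%:P + (2 * (h.1 - g.1))%:P * 'X.
Let py1 : {poly R} := g.2%:P.
Let px2 : {poly R} :=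
  h.1%:P + (8 * sgn * (r - a))%:P * ((1%:P - 'X) * (2%:P * 'X - 1%:P)).
(** The cubic is the antiderivative of [24 p] with value -1 at 1/2 and 0 at 1. *)
Let py2 : {poly R} := h.2%:P +
  (h.2 - g.2)%:P * (- 16%:P * 'X^3 + 36%:P * 'X^2 - 24%:P * 'X + 4%:P).

Definition connecting_curve t : R * R :=
  if t <= 2^-1 then (px1.[t], py1.[t]) else (px2.[t], py2.[t]).

Let px1' t : (deriv px1).[t] = 2 * (h.1 - g.1).
Proof. by rewrite /px1 !poly.derivE !hornerE; ring. Qed.

Let py1' t : (deriv py1).[t] = 0.
Proof. by rewrite /py1 !poly.derivE !hornerE. Qed.

Let px2E t : px2.[t] = h.1 + 8 * sgn * (r - a) * ((1 - t) * (2 * t - 1)).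
Proof. by rewrite /px2 !hornerE. Qed.

Let px2' t : (deriv px2).[t] = 8 * sgn * (r - a) * (3 - 4 * t).
Proof. by rewrite /px2 !poly.derivE !hornerE; ring. Qed.

Let py2' t : (deriv py2).[t] = 24 * (h.2 - g.2) * ((1 - t) * (2 * t - 1)).
Proof. by rewrite /py2 !poly.derivE !hornerE /=; ring. Qed.

Let curve0 : connecting_curve 0 = g.
Proof.
rewrite /connecting_curve invr_ge0 ler0n /px1 /py1 !hornerE.
by rewrite -surjective_pairing.
Qed.

Let curve1 : connecting_curve 1 = h.
Proof.
rewrite /connecting_curve ifF; last by apply/negbTE; rewrite -ltNge; lra.
rewrite [RHS]surjective_pairing /px2 /py2 !hornerE.
by congr (_, _); rewrite ?expr1n /=; ring.
Qed.

Let curve_left : {in `[0, 2^-1], forall t,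
  connecting_curve t = (px1.[t], py1.[t])}.
Proof.
by move=> t; rewrite in_itv/= /connecting_curve => /andP[_ ->].
Qed.

(** At 1/2 the definition selects the first branch, but both branches pass through [(h.1, g.2)]
    there. *)
Let curve_right : {in `[2^-1, 1], forall t,
  connecting_curve t = (px2.[t], py2.[t])}.
Proof.
move=> t; rewrite in_itv/= le_eqVlt /connecting_curve => /andP[+ _].
move=> /predU1P[<-|]; last by rewrite ltNge => /negbTE ->.
rewrite lexx /px1 /py1 /px2 /py2 !hornerE; congr (_, _); by rewrite /=; field.
Qed.

Let C1_left1 : C1_on 0 2^-1 (fun t => (connecting_curve t).1)
  (horner (deriv px1)).
Proof.
by apply: eq_C1_on (horner_C1_on _ _ _) => t /curve_left ->.
Qed.

Let C1_left2 : C1_on 0 2^-1 (fun t => (connecting_curve t).2)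
  (horner (deriv py1)).
Proof.
by apply: eq_C1_on (horner_C1_on _ _ _) => t /curve_left ->.
Qed.

Let C1_right1 : C1_on 2^-1 1 (fun t => (connecting_curve t).1)
  (horner (deriv px2)).
Proof.
by apply: eq_C1_on (horner_C1_on _ _ _) => t /curve_right ->.
Qed.

Let C1_right2 : C1_on 2^-1 1 (fun t => (connecting_curve t).2)
  (horner (deriv py2)).
Proof.
by apply: eq_C1_on (horner_C1_on _ _ _) => t /curve_right ->.
Qed.

Let v0 : 0 <= v. Proof. exact: normr_ge0. Qed.
Let a0 : 0 <= a. Proof. exact: normr_ge0. Qed.
Let r0 : 0 <= r. Proof. exact: sqrtr_ge0. Qed.
Let ar : a <= r. Proof. by rewrite /r addrC normr_le_sqrt_sqrD. Qed.
Let r2 : r ^+ 2 = v + a ^+ 2.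
Proof. by rewrite sqr_sqrtr ?addr_ge0 ?sqr_ge0// real_normK ?num_real. Qed.
Let vr : v / r * r = v.
Proof.
have [r_eq0|] := eqVneq r 0; last by move=> /divfK ->.
have : v + a ^+ 2 = 0 by rewrite -r2 r_eq0 expr0n.
by rewrite r_eq0 mulr0; have := sqr_ge0 a; move: v0; lra.
Qed.
Let w0 : 0 <= v / r. Proof. exact: divr_ge0. Qed.
(** As [a <= r], [(r - a) r <= r^2 - a^2 = v]: the horizontal excursion costs no more than the
    change of [y]. *)
Let sw : r - a <= v / r.
Proof.
have [r_eq0|rn0] := eqVneq r 0.
  by rewrite r_eq0 invr0; move: a0 ar; rewrite r_eq0; lra.
rewrite ler_pdivlMr; last by rewrite lt_def rn0.
by move: r2 a0 ar; nra.
Qed.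
Let h1E : h.1 = sgn * a.
Proof.
rewrite /sgn /a; case: ifPn => [h0|]; first by rewrite ger0_norm ?mul1r.
by rewrite -ltNge => h0; rewrite ltr0_norm// mulN1r opprK.
Qed.
Let sgn1 : `|sgn| = 1.
Proof. by rewrite /sgn; case: ifP => _; rewrite ?normrN normr1. Qed.

(** One bound with two uses: it makes the loop horizontal where [x = 0], and it estimates its
    length. *)
Let right_snd_le t : t \in `[2^-1, 1] ->
  `|(deriv py2).[t]| <= `|px2.[t]| * (3 * (v / r)).
Proof.
rewrite in_itv/= => /andP[t2 t1]; rewrite px2E py2' {1}h1E.
have : 0 <= (1 - t) * (2 * t - 1) by apply: mulr_ge0; lra.
(* Indeed [1 - 8 p = (4 t - 3)^2]. *)
have : 8 * ((1 - t) * (2 * t - 1)) <= 1 by have := sqr_ge0 (4 * t - 3); nra.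
move: ((1 - t) * (2 * t - 1)) => p p1 p0.
have -> : sgn * a + 8 * sgn * (r - a) * p =
    sgn * (a + (r - a) * (8 * p)) by ring.
have q0 : 0 <= a + (r - a) * (8 * p).
  by apply: addr_ge0 => //; apply: mulr_ge0; [rewrite subr_ge0|exact: mulr_ge0].
rewrite [X in _ <= X * _]normrM sgn1 mul1r (ger0_norm q0).
rewrite !normrM (distrC h.2) -/v (ger0_norm p0) ger0_norm// -{1}vr.
have rp : r * (8 * p) <= a + (r - a) * (8 * p).
  by have := ler_wpM2l a0 p1; lra.
by have := ler_wpM2r w0 rp; lra.
Qed.

Lemma admissible_connecting_curve : admissible_curve connecting_curve.
Proof.
exists [:: 2^-1; 1].
  rewrite /itv_partition/=; split=> //; rewrite andbT.
  by apply/andP; split; lra.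
move=> [|[|//]] _ /=.
  by exists (horner (deriv px1)), (horner (deriv py1)); split.
exists (horner (deriv px2)), (horner (deriv py2)); split => // t t21.
rewrite (curve_right t21)/= => x0; apply/eqP; rewrite -normr_le0.
by apply: le_trans (right_snd_le t21) _; rewrite x0 normr0 mul0r.
Qed.

Lemma CC_length_connecting_curve :
  (CC_length connecting_curve <= (2 * `|g.1 - h.1| + 11 * (v / r))%:E)%E.
Proof.
set K := _ + _.
have u0 := normr_ge0 (g.1 - h.1).
have mN := measurable_speed admissible_connecting_curve.
have h0 : 0 <= 2^-1 :> R by lra.
have h1 : 2^-1 <= 1 :> R by lra.
rewrite CC_lengthE (ge0_integral_itvU h0 h1 mN (speed_ge0 _)).
(* [K] bounds the speed on each half of [[0, 1]]. *)
have -> : K%:E = ((K * (2^-1 - 0))%:E + (K * (1 - 2^-1))%:E)%E.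
  by rewrite -EFinD; congr EFin; field.
apply: leeD; (apply: integral_itvcc_le; [by []| |exact: speed_ge0|]).
- exact: measurable_speed_C1 C1_left1 C1_left2.
- move=> t t02.
  rewrite /K; apply: speed_le; first by rewrite mulr_ge0.
    rewrite derive1E; have [_ ->] := C1_on_is_derive C1_left1 t02.
    by rewrite px1' normrM ger0_norm// distrC.
  rewrite derive1E; have [_ ->] := C1_on_is_derive C1_left2 t02.
  by rewrite py1' normr0; apply: mulr_ge0 => //; exact: mulr_ge0.
- exact: measurable_speed_C1 C1_right1 C1_right2.
move=> t t21; have tS := subset_itv_oo_cc t21.
(* The 8 comes from [|x'| = 8 (r - a) |3 - 4 t|], the 3 from [right_snd_le]. *)
apply: (@le_trans _ _ (8 * (v / r) + 3 * (v / r))); last first.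
  by rewrite /K; lra.
apply: speed_le; first by rewrite mulr_ge0.
  rewrite derive1E; have [_ ->] := C1_on_is_derive C1_right1 t21.
  have t34 : `|3 - 4 * t| <= 1.
    move: tS; rewrite in_itv/= ler_norml => /andP[? ?].
    by apply/andP; split; lra.
  have s0 : 0 <= r - a by rewrite subr_ge0.
  rewrite px2' !normrM sgn1 mulr1 (ger0_norm s0) ger0_norm// -[leRHS]mulr1.
  by apply: ler_pM => //; rewrite ?mulr_ge0// ler_pM2l.
rewrite derive1E; have [_ ->] := C1_on_is_derive C1_right2 t21.
by rewrite (curve_right tS); exact: right_snd_le.
Qed.

Lemma exists_short_curve : exists gamma K,
  [/\ [/\ admissible_curve gamma, gamma 0 = g & gamma 1 = h],
     (CC_length gamma <= K%:E)%E, 0 <= K &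
     K * (K + `|h.1|) <=
     258 * euclidean_dist (grushin_map g) (grushin_map h)].
Proof.
exists connecting_curve, (2 * `|g.1 - h.1| + 11 * (v / r)); split.
- by split => //; exact: admissible_connecting_curve.
- exact: CC_length_connecting_curve.
- by rewrite addr_ge0// mulr_ge0.
have [D1 D2] := euclidean_dist_ge (grushin_map g) (grushin_map h).
have := mulr_normB_ge g.1 h.1.
have := ler_normB g.1 h.1.
rewrite /= in D1 D2; rewrite -/v in D2.
move: D1 D2; rewrite -/a; set E := euclidean_dist _ _; set D := `|_ - h.1 * _|.
have := normr_ge0 (g.1 - h.1); have := normr_ge0 g.1.
set u := `|g.1 - h.1|; set b := `|g.1| => b0 u0 DE vE uba ubD.
(* The triangle inequality gives [u + a <= 2 (b + a)], and [u (b + a) <= 2 D <= 2 E]. *)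
have uuE : u * (u + a) <= 4 * E.
  have : u * (u + a) <= u * (2 * (b + a)) by rewrite ler_wpM2l//; lra.
  by lra.
set w := v / r; have ww : 0 <= w by [].
have wr : w * r = v by exact: vr.
(* Since [w r = v <= r^2]. As also [a <= r], both [w^2] and [w a] are at most [w r = v]. *)
have wler : w <= r.
  have [r_eq0|rn0] := eqVneq r 0; first by rewrite /w r_eq0 invr0 mulr0.
  have rgt0 : 0 < r by rewrite lt_def rn0.
  by rewrite -(ler_pM2r rgt0) wr -expr2 r2 lerDl sqr_ge0.
have w2v : w * w <= v by rewrite -wr ler_wpM2l.
have wav : w * a <= v by rewrite -wr ler_wpM2l.
(* With [K = 2 u + 11 w] and [2 u w <= u^2 + w^2], [K (K + a) <= 26 u (u + a) + 143 w^2 + 11 w a <=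
   104 E + 154 v], and [v <= E]. *)
by have := sqr_ge0 (u - w); have := sqr_ge0 u; have := mulr_ge0 u0 a0; nra.
Qed.
End Connect.
End Lower.

(** * Passage to the infimum, the control function, injectivity *)

Section Distance.
Context {R : realType}.
Implicit Types (g h : R * R).

(** The short curve makes the infimum finite, so [fine] loses nothing, and gives the last bound; the
    middle one holds for every curve and passes to the infimum. *)
Lemma CC_dist_bounds g h :
  let E := euclidean_dist (grushin_map g) (grushin_map h) in
  let d := CC_dist g h in
  [/\ 0 <= d, E <= 3 * (d * (d + `|h.1|)) & d * (d + `|h.1|) <= 258 * E].
Proof.
move=> E; rewrite /CC_dist.
set S := [set CC_length gamma | gamma in _]; set d := fine _.
have a0 := normr_ge0 h.1; set a := `|h.1| in a0 *.
have [gamma [K [adm lenK K0 KE]]] := exists_short_curve g h.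
have infK : (ereal_inf S <= K%:E)%E.
  by apply: le_trans lenK; apply: ereal_inf_lbound; exists gamma.
have inf0 : (0 <= ereal_inf S)%E.
  by apply: le_ereal_inf_tmp => _ [f _ <-]; exact: CC_length_ge0.
have dE : ereal_inf S = d%:E.
  by rewrite fineK// ge0_fin_numE// (le_lt_trans infK) ?ltry.
move: infK inf0; rewrite dE !lee_fin => dK d0.
split=> //; last first.
  by apply: le_trans KE; apply: ler_pM; rewrite ?addr_ge0 ?lerD2r.
(* q - a / 2 is the root L >= 0 of 3 L (L + a) = E, and L |-> L (L + a)
   increases. *)
have E0 : 0 <= E by exact: sqrtr_ge0.
have q0 : 0 <= a ^+ 2 / 4 + E / 3.
  by rewrite addr_ge0// divr_ge0// sqr_ge0.
pose q := Num.sqrt (a ^+ 2 / 4 + E / 3).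
have q2 : q ^+ 2 = a ^+ 2 / 4 + E / 3 by rewrite sqr_sqrtr.
have qd : q - a / 2 <= d.
  rewrite -lee_fin -dE; apply: le_ereal_inf_tmp => _ [f [admf f0 f1] <-].
  have := CC_length_ge0 f; case lenL: (CC_length f) => [L| |] //; last first.
    by move=> _; exact: leey.
  rewrite !lee_fin => L0; have := grushin_dist_le_length admf lenL.
  rewrite f0 f1 -/E -/a lerBlDr => EL.
  (* Completing the square: [(L + a / 2)^2 = L (L + a) + a^2 / 4]. *)
  rewrite -(@ler_pXn2r _ 2) ?nnegrE ?sqrtr_ge0 ?addr_ge0 ?divr_ge0// q2.
  by lra.
have qda : q <= d + a / 2 by move: qd; rewrite lerBlDr.
have qn0 : 0 <= q by exact: sqrtr_ge0.
have := ler_pM qn0 qn0 qda qda.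
by rewrite -expr2 q2; lra.
Qed.

Lemma quadratic_homeomorphism_pos (C : R) : 0 < C ->
  homeomorphism_pos (fun t => C * (t + t ^+ 2)).
Proof.
(* The inverse solves [s / C + 1/4 = (t + 1/2)^2]. *)
move=> C0; exists (fun s => Num.sqrt (s / C + 4^-1) - 2^-1).
have Cn0 : C != 0 by rewrite gt_eqF.
have half : Num.sqrt (4^-1) = 2^-1 :> R.
  by rewrite (_ : 4^-1 = 2^-1 ^+ 2) ?sqrtr_sqr ?ger0_norm//; field.
split.
- move=> t t0; split; first by rewrite mulr_gt0// addr_gt0// exprn_gt0.
  rewrite (_ : _ + 4^-1 = (t + 2^-1) ^+ 2); last by field.
  by rewrite sqrtr_sqr ger0_norm ?addrK// addr_ge0// ltW.
- move=> t t0; have tC : 0 < t / C by rewrite divr_gt0.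
  split; first by rewrite subr_gt0 -half ltr_sqrt ?ltrDr// addr_gt0.
  have q2 : Num.sqrt (t / C + 4^-1) ^+ 2 = t / C + 4^-1.
    by rewrite sqr_sqrtr// addr_ge0// ltW.
  rewrite -[RHS](divfK Cn0) mulrC; congr (_ * _).
  move: q2; set q := Num.sqrt _ => q2.
  by rewrite -[RHS](addrK 4^-1) -q2; field.
- apply: continuous_subspaceT.
  rewrite (_ : (fun t => _) = horner (C%:P * ('X + 'X^2))).
    exact: continuous_horner.
  by apply/funext => t; rewrite !hornerE.
apply: continuous_subspaceT.
rewrite (_ : (fun s => _) =
  horner ('X - (2^-1)%:P) \o Num.sqrt \o horner (C^-1 *: 'X + (4^-1)%:P)).
  move=> t; apply: continuous_comp; first exact: continuous_horner.
  apply: continuous_comp; [exact: sqrt_continuous|exact: continuous_horner].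
by apply/funext => t; rewrite /= !hornerE mulrC.
Qed.

Lemma quadratic_increasing_pos (C : R) : 0 < C ->
  increasing_pos (fun t => C * (t + t ^+ 2)).
Proof.
move=> C0 s t s0 st; rewrite ltr_pM2l// ltrD// ltr_pXn2r// nnegrE ltW//.
exact: lt_trans st.
Qed.

Lemma grushin_map_inj : injective (@grushin_map R).
Proof.
move=> [x1 y1] [x2 y2] [/= e ->]; congr (_, _).
have := mulr_normB_ge x1 x2; rewrite e subrr normr0 mulr0.
apply: contraTeq => x12; rewrite -ltNge.
have d0 : 0 < `|x1 - x2| by rewrite normr_gt0 subr_eq0.
by rewrite mulr_gt0// (lt_le_trans d0)// ler_normB.
Qed.

Lemma euclidean_dist_gt0 (p q : R * R) : p <> q -> 0 < euclidean_dist p q.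
Proof.
move=> pq; rewrite lt_def sqrtr_ge0 andbT; apply/eqP => d0; apply: pq.
have [] := euclidean_dist_ge p q; rewrite d0 !normr_le0 !subr_eq0.
by move: p q {d0} => [p1 p2] [q1 q2] /= /eqP -> /eqP ->.
Qed.

End Distance.

Theorem theorem8 (R : realType) :
  quasisymmetric (@CC_dist R) (@euclidean_dist R) (@grushin_map R).
Proof.
have C0 : 0 < 774 :> R by rewrite ltr0n.
exists (fun t => 774 * (t + t ^+ 2)); split.
- exact: quadratic_homeomorphism_pos C0.
- exact: quadratic_increasing_pos C0.
split=> [|z1 z2 z3 z21 z31]; first exact: grushin_map_inj.
have F12 : grushin_map z2 <> grushin_map z1 by move/grushin_map_inj.
have E2 := euclidean_dist_gt0 F12.
have [d3 E3d _] := CC_dist_bounds z3 z1.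
have [d2 E2d dE2] := CC_dist_bounds z2 z1.
rewrite ler_pdivrMr//; set a := `|z1.1| in E3d E2d dE2 *.
have a0 : 0 <= a by exact: normr_ge0.
(* A vanishing distance would force the image distance, which is positive, to vanish. *)
have {}d2 : 0 < CC_dist z2 z1.
  rewrite lt_def d2 andbT; apply: contraTneq E2 => d20.
  by move: E2d; rewrite d20 mul0r mulr0 leNgt.
have t0 : 0 <= CC_dist z3 z1 / CC_dist z2 z1 by rewrite divr_ge0// ltW.
have d3E : CC_dist z3 z1 = CC_dist z3 z1 / CC_dist z2 z1 * CC_dist z2 z1.
  by rewrite divfK// gt_eqF.
move: t0 d3E E3d dE2; set t := _ / _.
move: (CC_dist z2 z1) (CC_dist z3 z1) d2 => d2' d3' d20 t0 -> E3d dE2.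
(* With [d = d2'], [t d (t d + a)] is [(t + t^2) d (d + a)] without the nonnegative terms [t d^2]
   and [t^2 d a]; then 774 is 3 times 258. *)
have := ler_wpM2l (addr_ge0 t0 (sqr_ge0 t)) dE2.
have := mulr_ge0 (mulr_ge0 t0 (ltW d20)) (ltW d20).
have := mulr_ge0 (mulr_ge0 (sqr_ge0 t) (ltW d20)) a0.
by lra.
Qed.
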